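(* Let $\mathcal{D}=\{\mathbf{d}_n\}_{n=1}^M$ be a dictionary for $\mathbb{R}^{N_b}$ and let $\mathbf{F}\in\mathbb{R}^{N\times L}$ be an $L$-channel signal partitioned into $Q$ blocks $\mathbf{F}_q\in\mathbb{R}^{N_b\times L}$ with columns $\mathbf{f}_{q,j}\in\mathbb{R}^{N_b}$, $j=1,\ldots,L$, $q=1,\ldots,Q$, $QN_b=N$. Suppose that for each block $q$ the $k_q$-term atomic decompositions $$\mathbf{f}_{q,j}^{k_q}=\sum_{n=1}^{k_q}c_{q,j}^{k_q}(n)\,\mathbf{d}_{\ell^q_n}=\hat{P}_{\mathbb{V}_{k_q}^q}\mathbf{f}_{q,j},\qquad j=1,\ldots,L,$$ are known, where $\mathbb{V}_{k_q}^q=\operatorname{span}\{\mathbf{d}_{\ell^q_n}\}_{n=1}^{k_q}$. For each $q$ let an index $\ell^q_{k_q+1}\notin\{\ell^q_n\}_{n=1}^{k_q}$ be selected by the same criterion as the one used to choose the atoms $\mathbf{d}_{\ell^q_n}$, $n=1,\ldots,k_q$ (whatever that criterion is), and set $$\mathbf{w}_{k_q+1}^q=\mathbf{d}_{\ell^q_{k_q+1}}-\hat{P}_{\mathbb{V}_{k_q}^q}\mathbf{d}_{\ell^q_{k_q+1}},\qquad \mathbf{w}_1^q=\mathbf{d}_{\ell_1^q},$$ where $\mathbf{w}_{k_q+1}^q\neq 0$ for every $q$. Let $K=\sum_{q=1}^Qk_q$. At iteration $K+1$ the atomic decomposition of exactly one block is upgraded, by incorporating the atom $\mathbf{d}_{\ell^q_{k_q+1}}$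 if the upgraded block is block $q$; let $\mathbf{R}^{K+1}$ be the resulting total residual. Then, in order to minimize $\|\mathbf{R}^{K+1}\|_F^2$ over the choice of the block to be upgraded, the atomic decomposition to be upgraded at iteration $K+1$ should correspond to the block $q^\star$ such that $$q^\star=\operatorname*{arg\,max}_{q=1,\ldots,Q}\frac{\sum_{j=1}^L|\langle\mathbf{w}_{k_q+1}^q,\mathbf{f}_{q,j}\rangle|^2}{\|\mathbf{w}_{k_q+1}^q\|^2};$$ that is, the blocks whose upgrade minimizes $\|\mathbf{R}^{K+1}\|_F^2$ are those attaining this maximum.
   Context: A dictionary for $\mathbb{R}^{N_b}$ is an over-complete set $\mathcal{D}=\{\mathbf{d}_n\in\mathbb{R}^{N_b};\ \|\mathbf{d}_n\|=1\}_{n=1}^M$ of unit vectors, called atoms. The selected atoms may depend on the block $q$ but are the same for all $L$ channels of that block. $\langle\cdot,\cdot\rangle$ and $\|\cdot\|$ are the Euclidean inner product and norm, $\|\cdot\|_F$ is the Frobenius norm, and $\hat{P}_{\mathbb{V}}$ is the orthogonal projection of $\mathbb{R}^{N_b}$ onto the subspace $\mathbb{V}$. If $k_q=0$, then $\mathbb{V}_0^q=\{0\}$ and the approximation of block $q$ is zero. Concatenation of blocks: the matrix $\mathbf{F}\in\mathbb{R}^{QN_b\times L}$ is the concatenation of $\mathbf{F}_1,\ldots,\mathbf{F}_Q\in\mathbb{R}^{N_b\times L}$ if $F(i,j)=F_q(i-(q-1)N_b,\,j)$ for $i=(q-1)N_b+1,\ldots,qN_b$, $q=1,\ldots,Q$,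 $j=1,\ldots,L$ (blocks stacked vertically); saying that $\mathbf{F}$ is partitioned into the $\mathbf{F}_q$ means that $\mathbf{F}$ is their concatenation. Residuals: for a block $p$ approximated with $k_p$ atoms, $\mathbf{R}_p^{k_p}=\mathbf{F}_p-\mathbf{F}_p^{k_p}$, where $\mathbf{F}_p^{k_p}$ has columns $\mathbf{f}_{p,j}^{k_p}=\hat{P}_{\mathbb{V}_{k_p}^p}\mathbf{f}_{p,j}$, $j=1,\ldots,L$. Upgrading block $q$ means replacing $\mathbb{V}_{k_q}^q$ by $\mathbb{V}_{k_q+1}^q=\operatorname{span}\{\mathbf{d}_{\ell^q_n}\}_{n=1}^{k_q+1}$ and each $\mathbf{f}_{q,j}^{k_q}$ by $\mathbf{f}_{q,j}^{k_q+1}=\hat{P}_{\mathbb{V}_{k_q+1}^q}\mathbf{f}_{q,j}$, leaving all other blocks unchanged. The total residual $\mathbf{R}^{K+1}$ when block $q$ is upgraded is the concatenation of the blocks $\mathbf{R}_p^{k_p}$, $p\neq q$, and $\mathbf{R}_q^{k_q+1}=\mathbf{F}_q-\mathbf{F}_q^{k_q+1}$ (in position $q$). *)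

(* Defs.v *)
From HB Require Import structures.
From mathcomp Require Import all_boot all_order all_algebra.
From mathcomp Require Import sesquilinear reals.

Set Implicit Arguments.
Unset Strict Implicit.
Unset Printing Implicit Defensive.

Import Order.TTheory GRing.Theory Num.Theory.
Local Open Scope ring_scope.

Section Euclidean.
Variable R : realType.

Definition dot n (x y : 'cV[R]_n) : R := \sum_(i < n) x i 0 * y i 0.

Definition enorm n (x : 'cV[R]_n) : R := Num.sqrt (dot x x).

Definition fnorm m n (A : 'M[R]_(m, n)) : R :=
  Num.sqrt (\sum_(i < m) \sum_(j < n) `|A i j| ^+ 2).

Lemma dotC n (x y : 'cV[R]_n) : dot x y = dot y x.
Proof. by apply: eq_bigr => i _; rewrite mulrC. Qed.

Lemma dot_linearr n (x : 'cV[R]_n) : GRing.linear_for *%R (dot x).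
Proof.
move=> a u v; rewrite /dot mulr_sumr -big_split; apply: eq_bigr => i _ /=.
by rewrite !mxE mulrDr mulrCA.
Qed.

Fact dot_bilinear n : bilinear_for *%R (idfun \; *%R) (@dot n).
Proof.
split=> [y|]; last exact: dot_linearr.
by move=> a u v; rewrite /= ![dot _ y]dotC dot_linearr.
Qed.

HB.instance Definition _ n :=
  bilinear_isBilinear.Build R 'cV[R]_n 'cV[R]_n R _ _ (@dot n)
    (dot_bilinear n).

Fact dot_hermitian n (x y : 'cV[R]_n) :
  dot x y = (-1) ^+ false * idfun (dot y x).
Proof. by rewrite mul1r dotC. Qed.

HB.instance Definition _ n :=
  isHermitianSesquilinear.Build R 'cV[R]_n false idfun (@dot n)
    (@dot_hermitian n).

Lemma dot_eq0 n (x : 'cV[R]_n) : (dot x x == 0) = (x == 0).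
Proof.
apply/eqP/eqP => [|->]; last by rewrite /dot big1 // => i _; rewrite mxE mul0r.
move=> /eqP; rewrite psumr_eq0; last by move=> i _; rewrite -expr2 sqr_ge0.
move=> /allP x0; apply/colP => i; rewrite mxE; apply/eqP.
by have := x0 i (mem_index_enum i); rewrite /= -expr2 sqrf_eq0.
Qed.

(* [orthov (@dot n) V] is the orthogonal complement of [V], so this is the
   projection onto [V] along it. *)
Definition orth_proj n (V : {vspace 'cV[R]_n}) : 'End('cV[R]_n) :=
  daddv_pi V (orthov (@dot n) V).

Lemma capv_orthov n (V : {vspace 'cV[R]_n}) :
  (V :&: orthov (@dot n) V = 0)%VS.
Proof.
apply/eqP; rewrite -subv0; apply/subvP => v; rewrite memv_cap memv0.
by case/andP => vV /mem_orthovP /(_ v vV) /= /eqP; rewrite dot_eq0.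
Qed.

Lemma addv_orthov n (V : {vspace 'cV[R]_n}) :
  (V + orthov (@dot n) V = fullv)%VS.
Proof.
pose b := vbasis V.
pose g := fun u : 'cV[R]_n => \row_(i < \dim V) dot b`_i u.
have glin : linear g.
  by move=> a u v; apply/rowP => i; rewrite !mxE dot_linearr.
pose gl := GRing.isLinear.Build _ _ _ _ g glin.
pose G : {linear 'cV[R]_n -> 'rV[R]_(\dim V)} := HB.pack g gl.
have kerG : (lker (linfun G) <= orthov (@dot n) V)%VS.
  apply/subvP => u; rewrite memv_ker lfunE /= => /eqP/rowP gu0.
  apply/mem_orthovP => v /coord_vbasis ->.
  rewrite /= dotC -[dot _ u]/((applyr (@dot n) u) _).
  rewrite linear_sum big1 // => i _; rewrite linearZ /=.
  by have := gu0 i; rewrite !mxE => ->; rewrite mulr0.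
apply/eqP; rewrite eqEdim subvf /= (dimv_disjoint_sum (capv_orthov V)).
rewrite -(limg_ker_dim (linfun G) fullv) capfv addnC.
rewrite leq_add ?dimvS //.
by apply: leq_trans (dimvS (subvf _)) _; rewrite dimvf /dim /= mul1n.
Qed.

Lemma orth_proj_mem n (V : {vspace 'cV[R]_n}) x : orth_proj V x \in V.
Proof. exact: memv_pi. Qed.

Lemma orth_proj_orth n (V : {vspace 'cV[R]_n}) x v :
  v \in V -> dot (x - orth_proj V x) v = 0.
Proof.
move=> vV; have xE : orth_proj V x + daddv_pi (orthov (@dot n) V) V x = x.
  by rewrite daddv_pi_add ?capv_orthov ?addv_orthov ?memvf.
rewrite -[x in x - _]xE addrC addKr.
by have /mem_orthovP := memv_pi (orthov (@dot n) V) V x; apply.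
Qed.

End Euclidean.

Section Dictionary.
Variables (R : realType) (n M : nat).

(* Over-complete: the atoms span the whole space, and there are more of them
   than its dimension. *)
Definition dictionary (d : 'I_M -> 'cV[R]_n) : Prop :=
  [/\ forall i, enorm (d i) = 1,
      <<codom d>>%VS = fullv
    & (n < M)%N].

Variables (d : 'I_M -> 'cV[R]_n) (l : nat -> 'I_M).

(* Indices are 0-based: [l 0], ..., [l k.-1] are the first [k] selected atoms,
   and [l k] is the next one. *)
Definition selected (k : nat) : seq 'I_M := [seq l i | i <- iota 0 k].

Definition sel_span (k : nat) : {vspace 'cV[R]_n} :=
  <<[seq d i | i <- selected k]>>%VS.

Definition wvec (k : nat) : 'cV[R]_n :=
  d (l k) - orth_proj (sel_span k) (d (l k)).

Lemma sel_span0 : sel_span 0 = 0%VS.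
Proof. by rewrite /sel_span span_nil. Qed.

Lemma wvec0 : wvec 0 = d (l 0%N).
Proof.
have := orth_proj_mem (sel_span 0) (d (l 0%N)).
by rewrite /wvec sel_span0 memv0 => /eqP ->; rewrite subr0.
Qed.

Variable L : nat.

Definition approx (B : 'M[R]_(n, L)) (k : nat) : 'M[R]_(n, L) :=
  \matrix_(i, j) orth_proj (sel_span k) (col j B) i 0.

Definition residual (B : 'M[R]_(n, L)) (k : nat) : 'M[R]_(n, L) :=
  B - approx B k.

End Dictionary.

Section Blocks.
Variables (R : realType) (N Nb L Q : nat).
Hypothesis hN : (Q * Nb = N)%N.

Fact sum_block_size : (\sum_(q < Q) Nb)%N = N.
Proof. by rewrite sum_nat_const card_ord. Qed.

Definition concat (B : 'I_Q -> 'M[R]_(Nb, L)) : 'M[R]_(N, L) :=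
  castmx (sum_block_size, erefl) (\mxcol_(q < Q) B q).

Lemma concatE (B : 'I_Q -> 'M[R]_(Nb, L)) (m : 'I_N) (q : 'I_Q)
    (i : 'I_Nb) (j : 'I_L) :
  m = (q * Nb + i)%N :> nat -> concat B m j = B q i j.
Proof.
move=> mE; rewrite castmxE /= cast_ord_id.
have -> : cast_ord (esym sum_block_size) m = @tagnat.Rank Q (fun=> Nb) q i.
  apply/val_inj; rewrite /= mE [RHS]tagnat.RankEsum; congr (_ + _)%N.
  rewrite (eq_bigl (fun p : 'I_Q => (p < q)%N)) //.
  rewrite -(big_ord_widen _ (fun=> Nb)) ?(ltnW (ltn_ord q)) //.
  by rewrite sum_nat_const card_ord.
by rewrite -[in RHS](@mxcolK _ Q (fun=> Nb) L B q) [RHS]mxE.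
Qed.

Variables (M : nat) (d : 'I_M -> 'cV[R]_Nb) (ell : 'I_Q -> nat -> 'I_M).
Variable F : 'I_Q -> 'M[R]_(Nb, L).

Definition total_residual (k : 'I_Q -> nat) : 'M[R]_(N, L) :=
  concat (fun q => residual d (ell q) (F q) (k q)).

End Blocks.

Definition upgrade Q (k : 'I_Q -> nat) (q : 'I_Q) : 'I_Q -> nat :=
  fun p => if p == q then (k p).+1 else k p.

Lemma sum_upgrade Q (k : 'I_Q -> nat) (q : 'I_Q) :
  (\sum_(p < Q) upgrade k q p = (\sum_(p < Q) k p).+1)%N.
Proof.
rewrite (bigD1 q) //= [in RHS](bigD1 q) //= /upgrade eqxx addSn.
by congr (_ + _).+1; apply: eq_bigr => p /negPf ->.
Qed.

Definition argmin (R : realType) (I : finType) (f : I -> R) : {set I} :=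
  [set i | [forall j, f i <= f j]].

Definition argmax (R : realType) (I : finType) (f : I -> R) : {set I} :=
  [set i | [forall j, f j <= f i]].

(* Main.v *)
(* Orthogonalising the new atom, V_{k+1} is the orthogonal sum of V_k and the
   line of w, so by Pythagoras upgrading block q lowers its squared residual by
   exactly sum_j <w, f_{q,j}>^2 / ||w||^2 and leaves the other blocks alone.
   The total is thus a constant minus this gain. *)
Require Import Defs.
From mathcomp Require Import all_boot all_order all_algebra.
From mathcomp Require Import sesquilinear reals.

Set Implicit Arguments.
Unset Strict Implicit.
Unset Printing Implicit Defensive.

Import Order.TTheory GRing.Theory Num.Theory.
Local Open Scope ring_scope.

Section Projection.
Variables (R : realType) (n : nat).
Implicit Types (V : {vspace 'cV[R]_n}) (x a p : 'cV[R]_n).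

(** The difference of [orth_proj V x] and [p] lies in [V] and is also orthogonal to [V], hence to
    itself. *)
Lemma orth_proj_unique V x p :
  p \in V -> (forall v, v \in V -> dot (x - p) v = 0) -> orth_proj V x = p.
Proof.
move=> pV px; apply/eqP; rewrite -subr_eq0 -dot_eq0; apply/eqP.
have uV : orth_proj V x - p \in V by rewrite rpredB ?orth_proj_mem.
rewrite {1}(_ : orth_proj V x - p = (x - p) - (x - orth_proj V x)); last first.
  by rewrite opprB [RHS]addrC addrA subrK.
by rewrite linearBl /= px ?orth_proj_orth // subr0.
Qed.

(** One Gram-Schmidt step: [w] is orthogonal to [V], and [a] differs from it by a vector of [V], so
    the projections onto [V] and onto the line of [w] add up. *)
Lemma orth_proj_addv_line V a x (w := a - orth_proj V a) :
  w != 0 ->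
  orth_proj (V + <[a]>) x = orth_proj V x + (dot w x / dot w w) *: w.
Proof.
move=> w0; have ww0 : dot w w != 0 by rewrite dot_eq0.
have aE : a = orth_proj V a + w by rewrite addrC subrK.
have wV v : v \in V -> dot w v = 0 by apply: orth_proj_orth.
apply: orth_proj_unique => [|_ /memv_addP[v vV [_ /vlineP[b ->] ->]]].
  have /subvP VW := addvSl V <[a]>%VS.
  have aW : a \in (V + <[a]>)%VS by apply: subvP (addvSr _ _) _ (memv_line a).
  by rewrite memvD ?memvZ // ?memvB // VW ?orth_proj_mem.
(* Trading [a] for [w] leaves orthogonality to be checked only against [V] and against [w]. *)
have -> : v + b *: a = (v + b *: orth_proj V a) + b *: w.
  by rewrite {1}aE scalerDr addrA.
have : v + b *: orth_proj V a \in V by rewrite memvD ?memvZ ?orth_proj_mem.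
move: (v + _) => u uV; clearbody w.
rewrite opprD addrA [LHS]linearBl !linearDr /= orth_proj_orth // add0r.
rewrite !linearZr_LR linearBl !linearZl_LR /= (wV u) //.
rewrite [dot (orth_proj V x) w]dotC wV ?orth_proj_mem // subr0 mulr0 add0r.
by rewrite [dot x w]dotC divfK ?subrr.
Qed.

Lemma dot_residual_addv_line V a x (w := a - orth_proj V a) :
  w != 0 ->
  dot (x - orth_proj (V + <[a]>) x) (x - orth_proj (V + <[a]>) x) =
  dot (x - orth_proj V x) (x - orth_proj V x) - dot w x ^+ 2 / dot w w.
Proof.
move=> w0; have ww0 : dot w w != 0 by rewrite dot_eq0.
rewrite orth_proj_addv_line // -/w opprD addrA.
(* This lets the gain involve the signal itself instead of its current residual. *)
have wx : dot w (x - orth_proj V x) = dot w x.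
  rewrite [LHS]linearBr /= (orth_proj_orth a (orth_proj_mem V x)).
  exact: subr0.
clearbody w; move: (x - _) wx => r wx; set t := dot w x / _.
rewrite linearBl !linearBr /= !linearZl_LR !linearZr_LR /= [dot r w]dotC wx.
(* The new residual [r - t *: w] is orthogonal to [w], so one cross term cancels the quadratic
   one. *)
rewrite (_ : t * dot w w = dot w x) ?divfK // subrr subr0.
by rewrite expr2 mulrAC.
Qed.

End Projection.

Lemma fnorm_sqr (R : realType) m n (A : 'M[R]_(m, n)) :
  fnorm A ^+ 2 = \sum_(j < n) dot (col j A) (col j A).
Proof.
rewrite sqr_sqrtr; last by do 2!apply: sumr_ge0 => ? _; apply: exprn_ge0.
rewrite exchange_big; apply: eq_bigr => j _.
apply: eq_bigr => i _.
by rewrite real_normK ?num_real // mxE expr2.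
Qed.

Lemma enorm_sqr (R : realType) n (x : 'cV[R]_n) : enorm x ^+ 2 = dot x x.
Proof. by rewrite sqr_sqrtr // sumr_ge0 // => i _; rewrite -expr2 sqr_ge0. Qed.

Lemma fnorm_concat_sqr (R : realType) (N Nb L Q : nat) (hN : (Q * Nb = N)%N)
    (B : 'I_Q -> 'M[R]_(Nb, L)) :
  fnorm (concat hN B) ^+ 2 = \sum_(q < Q) fnorm (B q) ^+ 2.
Proof.
under [RHS]eq_bigr do rewrite fnorm_sqr.
rewrite fnorm_sqr [RHS]exchange_big /=; apply: eq_bigr => j _.
rewrite /concat; move: (sum_block_size hN) => sN.
(* Once [N] is replaced by the sum of the block sizes, the cast is trivial and rows can be indexed
   by pairs of a block and a row in it. *)
case: N / sN {hN}; rewrite castmx_id.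
rewrite /dot sig_big_dep (reindex _ tagnat.sig_bij_on) /=.
by apply: eq_bigr => i _; rewrite !mxE.
Qed.

Section Selection.
Variables (R : realType) (n M L : nat) (d : 'I_M -> 'cV[R]_n) (l : nat -> 'I_M).

Lemma sel_spanS k : sel_span d l k.+1 = (sel_span d l k + <[d (l k)]>)%VS.
Proof.
by rewrite /sel_span /selected -[k.+1]addn1 iotaD !map_cat span_cat /= span_seq1.
Qed.

(** All channels of a block share their atoms, hence the same [w], so the gains of the columns add
    over a common denominator. *)
Lemma fnorm_residualS_sqr (B : 'M[R]_(n, L)) k (w := wvec d l k) :
  w != 0 ->
  fnorm (residual d l B k.+1) ^+ 2 =
  fnorm (residual d l B k) ^+ 2
  - (\sum_(j < L) `|dot w (col j B)| ^+ 2) / enorm w ^+ 2.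
Proof.
move=> w0; rewrite !fnorm_sqr enorm_sqr mulr_suml -sumrB.
have colE i j : col j (residual d l B i)
    = col j B - orth_proj (sel_span d l i) (col j B).
  by apply/colP => m; rewrite !mxE.
apply: eq_bigr => j _; rewrite !colE sel_spanS dot_residual_addv_line //.
by rewrite real_normK ?num_real.
Qed.

End Selection.

(** Equality of sets of optimisers, so ties are covered. *)
Lemma argmin_subl (R : realType) (I : finType) (C : R) (f g : I -> R) :
  (forall i, f i = C - g i) -> argmin f = argmax g.
Proof.
move=> fE; apply/setP => i; rewrite !inE; apply: eq_forallb => j.
by rewrite !fE lerD2l lerN2.
Qed.

Lemma sumr_decrease_one (V : zmodType) (I : finType) (f f' : I -> V) i x :
  f' i = f i - x -> (forall j, j != i -> f' j = f j) ->
  \sum_j f' j = \sum_j f j - x.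
Proof.
move=> f'i f'E; rewrite (bigD1 i) //= f'i [in RHS](bigD1 i) //= addrAC.
by congr (_ + _ - _); apply: eq_bigr.
Qed.

Theorem theorem2 (R : realType) (N Nb L Q M : nat) (hN : (Q * Nb = N)%N)
    (d : 'I_M -> 'cV[R]_Nb) (hd : dictionary d)
    (F : 'M[R]_(N, L)) (Fb : 'I_Q -> 'M[R]_(Nb, L)) (hF : F = concat hN Fb)
    (k : 'I_Q -> nat) (ell : 'I_Q -> nat -> 'I_M)
    (c : forall q : 'I_Q, 'I_L -> 'I_(k q) -> R)
    (hdec : forall (q : 'I_Q) (j : 'I_L),
      \sum_(n < k q) c q j n *: d (ell q n)
      = orth_proj (sel_span d (ell q) (k q)) (col j (Fb q)))
    (criterion : 'M[R]_(Nb, L) -> seq 'I_M -> 'I_M -> Prop)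
    (hsel : forall (q : 'I_Q) (n : nat), (n <= k q)%N ->
      criterion (Fb q) (selected (ell q) n) (ell q n))
    (hnew : forall q : 'I_Q, ell q (k q) \notin selected (ell q) (k q))
    (hw : forall q : 'I_Q, wvec d (ell q) (k q) != 0) :
  argmin (fun q : 'I_Q =>
            fnorm (total_residual hN d ell Fb (upgrade k q)) ^+ 2)
  = argmax (fun q : 'I_Q =>
      (\sum_(j < L) `|dot (wvec d (ell q) (k q)) (col j (Fb q))| ^+ 2)
      / enorm (wvec d (ell q) (k q)) ^+ 2).
Proof.
(* [C] is the squared total residual before the upgrade, which is independent of the block
   chosen. *)
apply: (argmin_subl
  (C := \sum_(p < Q) fnorm (residual d (ell p) (Fb p) (k p)) ^+ 2)) => s.
rewrite /total_residual fnorm_concat_sqr; apply: (sumr_decrease_one (i := s)).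
  by rewrite /upgrade eqxx; apply: fnorm_residualS_sqr.
by move=> t /negPf ts; rewrite /upgrade ts.
Qed.
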